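(* Let $\mathcal{M}$ be a uniform oriented matroid of rank $r\ge 2$ on $n$ elements with $n-r\le 4$. Then $\operatorname{diam}(G^*(\mathcal{M}))=n-r+2$.
   Context: Sign vectors: for a finite set $E$ and $X\in\{+,-,0\}^E$, write $X^+=\{e:X_e=+\}$, $X^-=\{e:X_e=-\}$, $X^0=\{e:X_e=0\}$, $\operatorname{supp}(X)=X^+\cup X^-$, and $-X$ for the componentwise negation. For sign vectors $X,Y$, the separating set is $S(X,Y)=(X^+\cap Y^-)\cup(X^-\cap Y^+)$, and the composition $X\circ Y$ is given by $(X\circ Y)_e=X_e$ if $X_e\neq 0$ and $(X\circ Y)_e=Y_e$ otherwise. An oriented matroid $\mathcal{M}=(E,\mathcal{C}^* )$ is a finite set $E$ together with a set $\mathcal{C}^*\subseteq\{+,-,0\}^E$ of (signed) cocircuits satisfying: (CC0) $\mathbf{0}\notin\mathcal{C}^*$; (CC1) $X\in\mathcal{C}^*\Rightarrow -X\in\mathcal{C}^*$; (CC2) if $X,Y\in\mathcal{C}^*$ and $\operatorname{supp}(X)\subseteq\operatorname{supp}(Y)$ then $X=\pm Y$; (CC3) if $X,Y\in\mathcal{C}^*$, $X\neq -Y$ and $e\in S(X,Y)$, then there is $Z\in\mathcal{C}^*$ with $Z^+\subseteq (X^+\cup Y^+)\setminus\{e\}$ and $Z^-\subseteq (X^-\cup Y^-)\setminus\{e\}$. The covectors of $\mathcal{M}$ are $\mathbf{0}$ together with all compositions $X^1\circ\cdots\circ X^k$ ($k\ge 1$) of cocircuits, partially ordered componentwise by $0<+$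 and $0<-$ ($+,-$ incomparable). The rank $r$ of $\mathcal{M}$ is the largest $k$ such that there is a chain $\mathbf{0}=V_0<V_1<\cdots<V_k$ of covectors. $\mathcal{M}$ is uniform if $|X^0|=r-1$ for every cocircuit $X$. The cocircuit graph $G^*(\mathcal{M})$ has the cocircuits as vertices, with distinct cocircuits $X,Y$ adjacent iff $|X^0\cap Y^0|\ge r-2$ and $S(X,Y)=\emptyset$. $\operatorname{diam}(G^*(\mathcal{M}))$ is the maximum graph distance between two cocircuits. *)

(* Defs.v *)
(* Sign vectors over a finite ground set E are encoded as
   {ffun E -> option bool}:  Some true = +,  Some false = -,  None = 0. *)
From mathcomp Require Import all_boot all_order.
Set Implicit Arguments. Unset Strict Implicit. Unset Printing Implicit Defensive.

Section SignVectors.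
Variable E : finType.

Definition svec := {ffun E -> option bool}.

Definition sv0 : svec := [ffun _ => None].
Definition svneg (X : svec) : svec := [ffun e => omap negb (X e)].
Definition svplus (X : svec) : {set E} := [set e | X e == Some true].
Definition svminus (X : svec) : {set E} := [set e | X e == Some false].
Definition svzero (X : svec) : {set E} := [set e | X e == None].
Definition svsupp (X : svec) : {set E} := svplus X :|: svminus X.
Definition svsep (X Y : svec) : {set E} :=
  (svplus X :&: svminus Y) :|: (svminus X :&: svplus Y).
Definition svcomp (X Y : svec) : svec :=
  [ffun e => if X e != None then X e else Y e].

Definition is_OM (C : {set svec}) : Prop :=
  [/\ sv0 \notin C,
      (forall X, X \in C -> svneg X \in C),
      (forall X Y, X \in C -> Y \in C -> svsupp X \subset svsupp Y ->
          X = Y \/ X = svneg Y) &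
      (forall X Y e, X \in C -> Y \in C -> X != svneg Y -> e \in svsep X Y ->
          exists2 Z, Z \in C &
            svplus Z \subset (svplus X :|: svplus Y) :\ e /\
            svminus Z \subset (svminus X :|: svminus Y) :\ e)].

Definition covector (C : {set svec}) (V : svec) : Prop :=
  exists s : seq svec, all (fun X => X \in C) s /\ V = foldr svcomp sv0 s.

Definition svle (V W : svec) : bool := [forall e, (V e == None) || (V e == W e)].
Definition svlt (V W : svec) : bool := (V != W) && svle V W.

Definition has_chain (C : {set svec}) (k : nat) : Prop :=
  exists s : seq svec, [/\ size s = k, (forall V, V \in s -> covector C V)
                         & path svlt sv0 s].

Definition OM_rank (C : {set svec}) (r : nat) : Prop :=
  has_chain C r /\ (forall k, has_chain C k -> k <= r).

Definition uniform (C : {set svec}) (r : nat) : Prop :=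
  forall X, X \in C -> #|svzero X| = r - 1.

Definition coc_adj (C : {set svec}) (r : nat) : rel svec :=
  fun X Y => [&& X \in C, Y \in C, X != Y,
                 r - 2 <= #|svzero X :&: svzero Y| & svsep X Y == set0].

Definition coc_dist_le (C : {set svec}) (r : nat) (X Y : svec) (k : nat) : Prop :=
  exists p : seq svec, [/\ path (coc_adj C r) X p, last X p = Y & size p <= k].

Definition coc_diam_eq (C : {set svec}) (r : nat) (d : nat) : Prop :=
  (forall X Y, X \in C -> Y \in C -> coc_dist_le C r X Y d) /\
  (exists X Y, [/\ X \in C, Y \in C &
     forall k, coc_dist_le C r X Y k -> d <= k]).

End SignVectors.

(* Main.v *)
(* The zero sets of the cocircuits are exactly the (r-1)-subsets of the ground
   set, and every cocircuit can be moved along any coline through it, in both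
   directions: one zero a of X becomes nonzero, one element of supp X becomes
   zero (a pivot). Let N = n - r + 1 = |supp X|, and let agree X Y be the set of
   elements where X and Y have the same nonzero sign.

   A pivot at a, with the sign Y_a, that does not leave through agree X Y enlarges
   the agreement by one, so as long as such pivots exist (from X or from Y) the
   distance is controlled by N - |agree X Y|. The key fact (pivot_miss) is that the
   pivots from X towards Y never all leave through the same element of agree X Y:
   eliminating them successively from -Y would give a cocircuit supported on
   supp X that is neither X nor -X. Hence cocircuits on a common coline are at
   distance at most N - |agree X Y|, and if X, Y admit no improving pivot then at
   least two elements of agree X Y are used on each side. As |agree X Y| plus the
   number of zeros of X outside Y^0 is at most N <= 5, only two situations remain:
   two such zeros, where a pivot from X and one from Y leave through a common
   element, and three such zeros, where two steps from X and one from Y reach a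
   common coline. Both cost a single additional step, giving N + 1 - |agree X Y|.

   For antipodes, a path of length N + 1 is found on any coline, and none is
   shorter because an element has to become zero before it changes sign. *)
Require Import Defs.
From mathcomp Require Import all_boot all_order.
From mathcomp Require Import zify.
Set Implicit Arguments. Unset Strict Implicit. Unset Printing Implicit Defensive.

Section OrientedMatroid.
Variables (E : finType) (C : {set svec E}).
Implicit Types (X Y Z V W : svec E) (A B F : {set E}).

(** * Zero sets of covectors along chains *)

Lemma in_svzero X e : (e \in svzero X) = (X e == None).
Proof. by rewrite inE. Qed.

Lemma in_svsep X Y e : (e \in svsep X Y) = (X e != None) && (Y e == omap negb (X e)).
Proof. by rewrite !inE; case: (X e) => [[]|]; case: (Y e) => [[]|]. Qed.

Lemma svnegK X : svneg (svneg X) = X.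
Proof. by apply/ffunP => e; rewrite !ffunE; case: (X e) => [[]|]. Qed.

Lemma svzeroN X : svzero (svneg X) = svzero X.
Proof. by apply/setP => e; rewrite !inE ffunE; case: (X e). Qed.

Lemma svsuppE X : svsupp X = ~: svzero X.
Proof. by apply/setP => e; rewrite !inE; case: (X e) => [[]|]. Qed.

(** A composition vanishes only where all its factors do, so any factor nonzero at [f] serves. *)
Lemma covector_supp V f : covector C V -> V f != None ->
  exists X, [/\ X \in C, X f != None & svzero V \subset svzero X].
Proof.
case=> s [sC ->]; elim: s sC => [|X s IH] /=; first by rewrite ffunE.
case/andP=> XC sC; rewrite ffunE; case: ifPn => [Xf _|_ /(IH sC)[Z [ZC Zf /subsetP sub]]].
  exists X; split=> //; apply/subsetP => e; rewrite !inE ffunE.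
  by case: ifPn => // /negPn.
exists Z; split=> //; apply/subsetP => e; rewrite inE ffunE => Ve; apply: sub.
by rewrite inE; case: ifPn Ve => // /negbTE->.
Qed.

Lemma svlt_zero V W : svlt V W -> svzero W \proper svzero V.
Proof.
case/andP=> VW /forallP le; apply/properP; split.
  apply/subsetP => e; rewrite !inE => /eqP We.
  by have := le e; rewrite We => /orP[].
have [e ne] : exists e, V e != W e.
  apply/existsP; apply: contraR VW => /existsPn eq; apply/eqP/ffunP => e.
  by apply/eqP; rewrite -[_ == _]negbK.
have := le e; rewrite (negbTE ne) orbF => Ve.
by exists e; rewrite !inE // -(eqP Ve) eq_sym.
Qed.

Lemma path_svlt_size V s : path (@svlt E) V s -> size s <= #|svzero V|.
Proof.
elim: s V => //= W s IH V /andP[/svlt_zero/proper_card lt /IH le].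
exact: leq_ltn_trans le lt.
Qed.

(** * Elementary consequences of the cocircuit axioms *)

Hypothesis OM : is_OM C.

Lemma svneg_mem X : X \in C -> svneg X \in C.
Proof. by case: OM => _ + _ _; apply. Qed.

Lemma svzero_sub_eq X Y : X \in C -> Y \in C -> svzero X \subset svzero Y ->
  X = Y \/ X = svneg Y.
Proof.
move=> XC YC sub; case: OM => _ _ CC2 _.
have [|->|->] := CC2 Y X YC XC; first by rewrite !svsuppE setCS.
  by left.
by right; rewrite svnegK.
Qed.

Lemma cocircuit_neq0 X : X \in C -> exists e, X e != None.
Proof.
move=> XC; case: OM => C0 _ _ _; apply/existsP; apply: contraR C0 => /existsPn X0.
suff <- : X = sv0 E by [].
by apply/ffunP => e; rewrite ffunE; apply/eqP/negPn/X0.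
Qed.

Lemma elimination X Y e : X \in C -> Y \in C -> X != svneg Y ->
    X e != None -> Y e = omap negb (X e) ->
  exists Z, [/\ Z \in C, Z e = None &
    forall f, [\/ Z f = None, Z f = X f | Z f = Y f]].
Proof.
move=> XC YC XY Xe Ye; case: OM => _ _ _ CC3.
have [|Z ZC [/subsetP plus /subsetP minus]] := CC3 X Y e XC YC XY.
  by rewrite in_svsep Xe Ye eqxx.
exists Z; split=> // [|f].
  have := plus e; have := minus e; rewrite !inE eqxx /=.
  by case: (Z e) => [[]|] //= ? ?; exfalso; auto.
have := plus f; have := minus f; rewrite !inE.
case: (Z f) => [[]|] //= min pl; last by constructor.
  by have /andP[_ /orP[]/eqP->] := pl isT; constructor.
by have /andP[_ /orP[]/eqP->] := min isT; constructor.
Qed.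

(** * Zero sets in the uniform case *)

Variable r : nat.
Hypothesis rank : OM_rank C r.
Hypothesis unif : uniform C r.
Hypothesis r_ge2 : 2 <= r.

Lemma rB1 : r - 1 = (r - 2).+1.
Proof. by case: r r_ge2 => [|[|k]]; rewrite // !subSS !subn0. Qed.

Lemma svzero_eq X A : X \in C -> r - 1 <= #|A| -> A \subset svzero X -> svzero X = A.
Proof. by move=> XC cA AX; apply/esym/eqP; rewrite eqEcard AX unif. Qed.

(** Up to a change of sign [Y] is opposite to [X] at [t]. Eliminating [t] yields a cocircuit
    vanishing on [t |: F], and uniformity allows no further zero. *)
Lemma zero_exchange F a b t : #|F| = r - 2 -> a \notin F -> b \notin F ->
    a != b -> t \notin F ->
    (exists2 X, X \in C & svzero X = a |: F) ->
    (exists2 X, X \in C & svzero X = b |: F) ->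
  exists2 X, X \in C & svzero X = t |: F.
Proof.
move=> cF aF bF ab tF [X XC zX] [Y YC zY].
have [ta|ta] := eqVneq t a; first by exists X; rewrite // ta.
have [tb|tb] := eqVneq t b; first by exists Y; rewrite // tb.
have Xt : X t != None by rewrite -in_svzero zX !inE negb_or ta.
have Yt : Y t != None by rewrite -in_svzero zY !inE negb_or tb.
have [W [WC zW Wt]] : exists W, [/\ W \in C, svzero W = b |: F & W t = omap negb (X t)].
  have [eqt|neqt] := eqVneq (Y t) (omap negb (X t)); first by exists Y.
  exists (svneg Y); rewrite svneg_mem // svzeroN ffunE; split=> //.
  by case: (X t) (Y t) Xt Yt neqt => [[]|] // [[]|].
have [|Z [ZC Zt Zf]] := elimination XC WC _ Xt Wt.
  apply: contraTneq ab => eqX; have : a \in svzero X by rewrite zX !inE eqxx.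
  by rewrite eqX svzeroN zW !inE (negbTE aF) orbF => ->.
exists Z => //; apply: svzero_eq => //; first by rewrite cardsU1 tF cF rB1.
apply/subsetP => f /setU1P[->|fF]; first by rewrite inE Zt.
rewrite inE; have Xf : X f = None by apply/eqP; rewrite -in_svzero zX !inE fF orbT.
have Wf : W f = None by apply/eqP; rewrite -in_svzero zW !inE fF orbT.
by case: (Zf f) => ->; rewrite ?Xf ?Wf.
Qed.

Definition all_zero_sets F := forall A, #|A| = r - 1 -> F \subset A ->
  exists2 X, X \in C & svzero X = A.

(** Induction on [#|A :\: svzero H|]. For [t] in [A] with [H t] nonzero, [A :\ t] extends to two
    known zero sets: by [f], from the hypothesis, and by a zero [h] of [H], from the induction.
    Exchange then yields [A]. *)
Lemma all_zero_sets_step V f : covector C V -> V f != None ->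
  all_zero_sets (f |: svzero V) -> all_zero_sets (svzero V).
Proof.
move=> cV Vf allf A; have [H [HC Hf VH]] := covector_supp cV Vf.
move: {2}#|A :\: svzero H| (leqnn #|A :\: svzero H|) => m.
elim: m A => [|m IH] A leA cA VA.
  have AH : A \subset svzero H by rewrite -setD_eq0 -cards_eq0 -leqn0.
  by exists H => //; apply: svzero_eq; rewrite ?cA.
have [fA|fA] := boolP (f \in A); first by apply: allf; rewrite // subUset sub1set fA.
have [AH|/subsetPn[t tA tH]] := boolP (A \subset svzero H).
  by exists H => //; apply: svzero_eq; rewrite ?cA.
have [h hH hA] : exists2 h, h \in svzero H & h \notin A.
  apply/subsetPn; apply: contra tH => HA.
  suff -> : svzero H = A by [].
  by apply/eqP; rewrite eqEcard HA unif ?cA /=.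
have tV : t \notin svzero V by apply: contra tH; apply: (subsetP VH).
have cF : #|A :\ t| = r - 2 by apply/eqP; rewrite -eqSS -rB1 -cA (cardsD1 t A) tA.
have VF : svzero V \subset A :\ t by rewrite subsetD1 VA.
have cU (x : E) : x \notin A -> #|x |: A :\ t| = r - 1.
  by move=> xA; rewrite cardsU1 cF !inE (negbTE xA) andbF rB1.
rewrite -(setD1K tA); apply: (@zero_exchange _ f h) => //.
- by rewrite !inE (negbTE fA) andbF.
- by rewrite !inE (negbTE hA) andbF.
- by apply: contraTneq hH => <-; rewrite inE.
- by rewrite !inE eqxx.
- by apply: allf; rewrite ?cU // setUS.
apply: IH; [|exact: cU|by apply: subset_trans VF _; apply: subsetUr].
rewrite -ltnS; apply: leq_trans leA; apply: proper_card; apply/properP; split.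
  apply/subsetP => x; rewrite !inE => /andP[xH /predU1P[xh|/andP[_ ->]]]; last by rewrite xH.
  by move: xH; rewrite xh -in_svzero hH.
by exists t; rewrite !inE ?tA -?in_svzero ?tH //= eqxx orbF; apply: contraNneq tH => ->.
Qed.

(** In a chain of length [r], the first nonzero covector has the zero set of a cocircuit, and each
    later step loses exactly one zero. The property therefore descends along the chain to the empty
    set. *)
Lemma zero_set_exists A : #|A| = r - 1 -> exists2 X, X \in C & svzero X = A.
Proof.
move=> cA; suff : all_zero_sets set0 by apply; rewrite ?sub0set.
have flag s V : path (@svlt E) V s -> (forall W, W \in V :: s -> covector C W) ->
    #|svzero V| <= size s -> all_zero_sets (svzero V) -> all_zero_sets set0.
  elim: s V => [|W s IH] V /=; first by rewrite leqn0 cards_eq0 => _ _ /eqP->.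
  case/andP=> VW Ws cov le all_V.
  have [sub [f fV fW]] := properP (svlt_zero VW).
  have cW := path_svlt_size Ws.
  have eqV : svzero V = f |: svzero W.
    apply/esym/eqP; rewrite eqEcard subUset sub1set fV sub cardsU1 fW /=.
    exact: leq_trans le _.
  have covW : covector C W by apply: cov; rewrite !inE eqxx orbT.
  apply: (IH W) => //.
  - by move=> Z Zs; apply: cov; rewrite inE Zs orbT.
  - exact: leq_trans (proper_card (svlt_zero VW)) le.
  by apply: (all_zero_sets_step (f := f)); rewrite -?in_svzero // -eqV.
case: rank => [[[|V s] [sz cov]] chain _]; first by move: r_ge2; rewrite -sz.
have /andP[V0 Vs] := chain.
have [_ [f _ fV]] := properP (svlt_zero V0).
have [||X [XC Xf VX]] := @covector_supp V f; first by apply: cov; rewrite mem_head.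
  by rewrite -in_svzero.
have szr : size s = r - 1 by rewrite -sz subn1.
have le : #|svzero V| <= size s by rewrite szr -(unif XC); apply: subset_leq_card.
apply: (flag s V) => // B cB VB; exists X => //.
have cV : #|svzero V| = r - 1 by apply/eqP; rewrite -szr eqn_leq le path_svlt_size.
have -> : B = svzero V by apply/esym/eqP; rewrite eqEcard VB cB cV /=.
by apply: svzero_eq; rewrite ?cV.
Qed.


(** * Pivots along colines *)

(** As in the simplex method, [a] enters the support and [e] leaves it; the coline is
    [svzero X :\ a]. *)
Definition pivot X a e X' : bool :=
  [&& X' \in C, X a == None, X e != None, X' e == None, X' a != None &
      [forall f, (f != a) ==> (f != e) ==> (X' f == X f)]].

Lemma pivotP X a e X' : reflect
  [/\ X' \in C, X a = None /\ X' a != None, X e != None /\ X' e = None &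
      forall f, f != a -> f != e -> X' f = X f] (pivot X a e X').
Proof.
apply: (iffP idP) => [/and5P[X'C /eqP Xa Xe /eqP X'e /andP[X'a /forallP same]]|].
  split=> // f fa fe; apply/eqP.
  by have /implyP/(_ fa)/implyP/(_ fe) := same f.
case=> X'C [Xa X'a] [Xe X'e] same; rewrite /pivot X'C Xa Xe X'e X'a !eqxx /=.
apply/forallP => f; apply/implyP => fa; apply/implyP => fe; exact/eqP/same.
Qed.

Arguments pivotP {X a e X'}.

(** Take the cocircuits on the coline with sign [s] at [a] that vanish somewhere on the support of
    [X]. One with fewest separations from [X] has none, since eliminating a separating element would
    give a better one. *)
Lemma pivot_exists X a (s : bool) : X \in C -> X a = None ->
  exists e X', pivot X a e X' /\ X' a = Some s.
Proof.
move=> XC Xa; pose F := svzero X :\ a.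
have aX : a \in svzero X by rewrite in_svzero Xa.
have cF : #|F| = r - 2 by apply/eqP; rewrite -eqSS -rB1 -(unif XC) (cardsD1 a (svzero X)) aX.
pose cand Z := [&& Z \in C, Z a == Some s & F \subset svzero Z].
have candP e : X e != None -> exists2 Z, cand Z & Z e = None.
  move=> Xe; have eF : e \notin F by rewrite !inE (negbTE Xe) andbF.
  have [|Z ZC zZ] := @zero_set_exists (e |: F); first by rewrite cardsU1 eF cF rB1.
  have Ze : Z e = None by apply/eqP; rewrite -in_svzero zZ setU11.
  have Za : Z a != None.
    rewrite -in_svzero zZ !inE eqxx /= orbF.
    by apply: contra Xe => /eqP <-; rewrite Xa.
  have FZ : F \subset svzero Z by rewrite zZ subsetUr.
  have [Zs|Zs] := eqVneq (Z a) (Some s); first by exists Z; rewrite // /cand ZC Zs eqxx.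
  exists (svneg Z); last by rewrite ffunE Ze.
  rewrite /cand svneg_mem // svzeroN FZ ffunE andbT /=.
  by case: (Z a) Za Zs => [[]|] //; case: s {cand}.
pose P Z := cand Z && [exists e, (X e != None) && (Z e == None)].
have [W0 PW0] : exists Z, P Z.
  have [e0 Xe0] := cocircuit_neq0 XC; have [Z cZ Ze] := candP e0 Xe0.
  by exists Z; rewrite /P cZ /=; apply/existsP; exists e0; rewrite Xe0 Ze.
case: (arg_minnP (fun Z => #|svsep X Z|) PW0) => W.
case/andP=> /and3P[WC /eqP Wa FW] /existsP[e /andP[Xe /eqP We]] Wmin.
exists e, W; split=> //.
have eF : e \notin F by rewrite !inE (negbTE Xe) andbF.
have zW : svzero W = e |: F.
  apply: svzero_eq; rewrite // ?cardsU1 ?eF ?cF ?rB1 //.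
  by rewrite subUset FW sub1set inE We eqxx.
have sep0 : svsep X W = set0.
  apply/eqP; apply/set0Pn => -[f]; rewrite in_svsep => /andP[Xf /eqP Wf].
  have [|Z [ZC Zf Zor]] := elimination XC WC _ Xf Wf.
    by apply/eqP => eqX; move: Xa; rewrite eqX ffunE Wa.
  have zFZ : F \subset svzero Z.
    apply/subsetP => g gF; have /setD1P[_] := gF; rewrite !in_svzero => /eqP Xg.
    have /(subsetP FW) := gF; rewrite in_svzero => /eqP Wg.
    by case: (Zor g) => ->; rewrite ?Xg ?Wg.
  have fF : f \notin F by rewrite !inE (negbTE Xf) andbF.
  have zZ : svzero Z = f |: F.
    apply: svzero_eq; rewrite // ?cardsU1 ?fF ?cF ?rB1 //.
    by rewrite subUset zFZ sub1set inE Zf eqxx.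
  have Za : Z a != None.
    rewrite -in_svzero zZ !inE eqxx /= orbF.
    by apply: contra Xf => /eqP <-; rewrite Xa.
  have PZ : P Z.
    rewrite /P /cand ZC zFZ andbT; apply/andP; split.
      by case: (Zor a) Za => ->; rewrite ?Xa ?Wa ?eqxx.
    by apply/existsP; exists f; rewrite Xf Zf.
  have := Wmin Z PZ; rewrite leqNgt => /negP; apply; apply: proper_card.
  apply/properP; split; last by exists f; rewrite in_svsep ?Wf ?Xf ?Zf ?eqxx; case: (X f) Xf.
  apply/subsetP => g; rewrite !in_svsep => /andP[Xg /eqP Zg]; rewrite Xg /=.
  case: (Zor g) => eqZ; move: Zg; rewrite eqZ; last by move->.
    by case: (X g) Xg.
  by case: (X g) Xg => [[]|].
apply/pivotP; split=> //; first by rewrite Wa.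
move=> f fa fe; have [Xf|Xf] := eqVneq (X f) None.
  by rewrite Xf; apply/eqP; rewrite -in_svzero zW !inE fa Xf eqxx orbT.
have Wf : W f != None by rewrite -in_svzero zW !inE (negbTE fe) (negbTE Xf) andbF.
have /setP/(_ f) := sep0; rewrite in_svsep inE Xf /=.
by case: (X f) (W f) Xf Wf => [[]|] // [[]|].
Qed.

(* [W] below ranges over the results of eliminating elements of [X^0] from [-Y]
   using the pivots through [c], all of which vanish at [c] and agree with [X] at
   [b]; a minimal [W] is supported on [supp X] but has the wrong sign at [c] or [b]. *)
Lemma pivot_miss X Y b c : X \in C -> Y \in C -> X c != None -> Y c = X c ->
    X b != None -> Y b = None ->
  exists a, [/\ X a = None, Y a != None &
    forall X', pivot X a c X' -> X' a != Y a].
Proof.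
move=> XC YC Xc Yc Xb Yb.
have bc : b != c by apply/eqP => bc; move: Xc; rewrite -Yc -bc Yb.
pose ok a := [&& X a == None, Y a != None &
  [forall X', pivot X a c X' ==> (X' a != Y a)]].
have [/existsP[a /and3P[/eqP Xa Ya /forallP all_a]]|/existsPn no] := boolP [exists a, ok a].
  by exists a; split=> // X'; apply/implyP.
have family a : X a = None -> Y a != None ->
    exists2 X', pivot X a c X' & X' a = Y a.
  move=> Xa Ya; have := no a; rewrite /ok Xa Ya /= => /forallPn[X'].
  by rewrite negb_imply negbK => /andP[? /eqP]; exists X'.
pose P W := [&& W \in C, (W b == None) || (W b == X b),
  (W c == None) || (W c == omap negb (X c)) &
  [forall a, (X a == None) ==> (W a == None) || (W a == omap negb (Y a))]].
have PY : P (svneg Y).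
  rewrite /P svneg_mem // !ffunE Yb Yc !eqxx !orbT /=.
  by apply/forallP => a; rewrite ffunE eqxx orbT implybT.
case: (arg_minnP (fun W => #|[set a | (X a == None) && (W a != None)]|) PY) => W.
case/and4P=> WC Wb Wc /forallP Wa Wmin.
have [/existsP[a /andP[/eqP Xa Wa0]]|/existsPn subW] :=
    boolP [exists a, (X a == None) && (W a != None)].
  have /implyP := Wa a; rewrite Xa (negbTE Wa0) => /(_ isT)/eqP WaE.
  have Ya : Y a != None by case: (Y a) WaE Wa0 => //= ->.
  have [X' /pivotP[X'C [_ X'a] [_ X'c] same] X'aE] := family a Xa Ya.
  have X'b : X' b = X b by apply: same => //; apply: contraNneq Xb => ->; rewrite Xa.
  have [||Z [ZC Za Zor]] := elimination X'C WC _ X'a.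
  - apply/eqP => eqX; have := X'b; rewrite eqX ffunE.
    by case/orP: Wb => /eqP->; case: (X b) Xb => [[]|].
  - by rewrite X'aE.
  have zer f : X f = None -> f != a -> [\/ Z f = None | Z f = W f].
    move=> Xf fa; have X'f : X' f = None.
      by rewrite same //; apply: contraNneq Xc => <-; rewrite Xf.
    by case: (Zor f) => ->; [left|left|right].
  have PZ : P Z.
    rewrite /P ZC /=; apply/and3P; split.
    - by case: (Zor b) => ->; rewrite ?X'b ?eqxx ?orbT.
    - by case: (Zor c) => ->; rewrite ?X'c ?eqxx.
    apply/forallP => f; apply/implyP => /eqP Xf.
    have [->|fa] := eqVneq f a; first by rewrite Za.
    by case: (zer f Xf fa) => -> //; have /implyP := Wa f; apply; rewrite Xf.
  have := Wmin Z PZ; rewrite leqNgt => /negP[]; apply: proper_card.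
  apply/properP; split; last by exists a; rewrite !inE Xa ?Za // Wa0.
  apply/subsetP => f; rewrite !inE => /andP[/eqP Xf Zf]; rewrite Xf /=.
  have fa : f != a by apply: contraNneq Zf => ->; rewrite Za.
  by case: (zer f Xf fa) => eqZ; move: Zf; rewrite eqZ.
have [|eqX|eqX] := @svzero_sub_eq X W XC WC.
- by apply/subsetP => f; rewrite !inE => Xf; have := subW f; rewrite Xf negbK.
- by move: Wc; rewrite -eqX; case: (X c) Xc => [[]|].
by move: Wb Xb; rewrite eqX ffunE; case: (W b) => [[]|].
Qed.

(** * Distance and adjacency *)

Lemma dist_le_trans X Y Z j k : coc_dist_le C r X Y j -> coc_dist_le C r Y Z k ->
  coc_dist_le C r X Z (j + k).
Proof.
move=> [p [Xp pY szp]] [q [Yq qZ szq]]; exists (p ++ q).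
by rewrite cat_path last_cat Xp pY Yq qZ size_cat leq_add.
Qed.

Lemma dist_le_leq X Y j k : j <= k -> coc_dist_le C r X Y j -> coc_dist_le C r X Y k.
Proof. by move=> jk [p [Xp pY szp]]; exists p; split=> //; apply: leq_trans jk. Qed.

Lemma dist_le0 X : coc_dist_le C r X X 0.
Proof. by exists [::]. Qed.

Lemma dist_le_adj X Y : coc_adj C r X Y -> coc_dist_le C r X Y 1.
Proof. by move=> XY; exists [:: Y]; rewrite /= XY. Qed.

Lemma coc_adj_sym X Y : coc_adj C r X Y = coc_adj C r Y X.
Proof.
rewrite /coc_adj andbCA eq_sym setIC; congr [&& _, _, _, _ & _ == _].
by apply/setP => e; rewrite !inE orbC andbC [X in _ || X]andbC.
Qed.

Lemma pivot_adj X a e X' : X \in C -> pivot X a e X' -> coc_adj C r X X'.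
Proof.
move=> XC /pivotP[X'C [Xa X'a] [Xe X'e] same]; rewrite /coc_adj XC X'C /=.
apply/and3P; split.
- by apply: contraNneq Xe => ->; rewrite X'e.
- apply: leq_trans (_ : #|svzero X :\ a| <= _).
    by rewrite -ltnS -rB1 -(unif XC) (cardsD1 a (svzero X)) inE Xa.
  apply/subset_leq_card/subsetP => f; rewrite !inE => /andP[fa /eqP Xf].
  have fe : f != e by apply: contraNneq Xe => <-; rewrite Xf.
  by rewrite same // Xf.
apply/eqP/setP => f; rewrite in_svsep inE.
have [->|fa] := eqVneq f a; first by rewrite Xa.
have [->|fe] := eqVneq f e; first by rewrite X'e; case: (X e) Xe.
by rewrite same //; case: (X f) => [[]|].
Qed.

(** * Agreement, and cocircuits on a common coline *)

Definition agree X Y : {set E} := [set e | (X e != None) && (Y e == X e)].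

Lemma agreeC X Y : agree X Y = agree Y X.
Proof.
by apply/setP => e; rewrite !inE; case: (X e) => [[]|]; case: (Y e) => [[]|].
Qed.

Local Notation N := (#|E| - (r - 1)).

Lemma card_supp X : X \in C -> #|~: svzero X| = N.
Proof. by move=> XC; rewrite cardsCs setCK unif. Qed.

Lemma card_svzeroD X Y : X \in C -> Y \in C ->
  #|svzero X :\: svzero Y| = #|svzero Y :\: svzero X|.
Proof.
by move=> XC YC; rewrite !cardsD setIC !unif.
Qed.

(** [agree X Y] and Y^0 \ X^0 are disjoint parts of supp X. *)
Lemma agree_bound X Y : X \in C -> Y \in C ->
  #|agree X Y| + #|svzero X :\: svzero Y| <= N.
Proof.
move=> XC YC; rewrite card_svzeroD // -(card_supp XC).
rewrite -cardsUI; have -> : agree X Y :&: (svzero Y :\: svzero X) = set0.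
  by apply/setP => e; rewrite !inE; case: (X e) => [[]|]; case: (Y e) => [[]|].
rewrite cards0 addn0; apply/subset_leq_card/subsetP => e; rewrite !inE.
by case: (X e).
Qed.

Lemma agree_pivot X Y a e X' : pivot X a e X' -> X' a = Y a -> e \notin agree X Y ->
  #|agree X' Y| = #|agree X Y|.+1.
Proof.
move=> /pivotP[X'C [Xa X'a] [Xe X'e] same] X'Ya eXY.
have aXY : a \notin agree X Y by rewrite inE Xa.
suff -> : agree X' Y = a |: agree X Y by rewrite cardsU1 aXY.
apply/setP => f; rewrite !inE.
have [->|fa] := eqVneq f a; first by rewrite X'a X'Ya eqxx.
have [->|fe] := eqVneq f e; last by rewrite same.
by rewrite X'e /=; move: eXY; rewrite inE => /negbTE->.
Qed.

Lemma pivot_toward X Y a : X \in C -> X a = None -> Y a != None ->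
  exists e X', pivot X a e X' /\ X' a = Y a.
Proof.
by move=> XC Xa; case: (Y a) => // s _; apply: pivot_exists.
Qed.

Lemma svzeroD_neq0 X Y : X \in C -> Y \in C -> svzero X != svzero Y ->
  svzero X :\: svzero Y != set0.
Proof.
move=> XC YC; apply: contra; rewrite setD_eq0 => XY.
by apply/eqP/esym/svzero_eq; rewrite ?unif.
Qed.

(** As [a] is the only zero of [X] outside Y^0, [pivot_miss] can only name [a]: its pivot towards
    [Y] never leaves through [agree X Y]. Each step gains an agreement and stays on the coline. *)
Lemma coline_dist X Y a : X \in C -> Y \in C -> svzero X :\: svzero Y = [set a] ->
  coc_dist_le C r X Y (N - #|agree X Y|).
Proof.
move: {2}(_ - #|_|) (leqnn (N - #|agree X Y|)) => m.
elim: m X a => [|m IH] X a le XC YC D.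
  by move: (agree_bound XC YC) le; rewrite D cards1; clear; lia.
have bnd := agree_bound XC YC; rewrite D cards1 in bnd.
have /setDP[] : a \in svzero X :\: svzero Y by rewrite D set11.
rewrite !in_svzero => /eqP Xa Ya.
have Da f : X f = None -> Y f != None -> f = a.
  by move=> Xf Yf; apply/set1P; rewrite -D !inE Xf Yf.
have [b Yb Xb] : exists2 b, Y b = None & X b != None.
  have /eqP := card_svzeroD YC XC; rewrite D cards1 => /cards1P[b Db].
  have /setDP[] : b \in svzero Y :\: svzero X by rewrite Db set11.
  by rewrite !in_svzero => /eqP Yb Xb; exists b.
have [e [X' [pv X'a]]] := pivot_toward XC Xa Ya.
have [X'C [_ X'a0] [Xe X'e] same] := pivotP pv.
have eXY : e \notin agree X Y.
  apply/negP; rewrite inE Xe => /eqP Ye.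
  have [a' [Xa' Ya' miss]] := pivot_miss XC YC Xe Ye Xb Yb.
  by have := miss X'; rewrite (Da a') // X'a eqxx => /(_ pv).
have agr := agree_pivot pv X'a eXY.
have [Ye|Ye] := eqVneq (Y e) None.
  have [|X'Y|X'Y] := @svzero_sub_eq X' Y X'C YC.
  - apply/subsetP => f; rewrite !in_svzero.
    have [->|fa] := eqVneq f a; first by rewrite (negbTE X'a0).
    have [->|fe] := eqVneq f e; first by rewrite Ye.
    rewrite same // => /eqP Xf; apply: contraTT fa => Yf.
    by rewrite negbK (Da f).
  - have := dist_le_adj (pivot_adj XC pv); rewrite X'Y; apply: dist_le_leq; move: bnd; clear; lia.
  by move: X'a; rewrite X'Y ffunE; case: (Y a) Ya => [[]|].
apply: dist_le_leq (dist_le_trans (dist_le_adj (pivot_adj XC pv)) (IH X' e _ X'C YC _)).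
- by rewrite agr; move: le bnd; clear; lia.
- by rewrite agr; move: le bnd; clear; lia.
apply/setP => f; rewrite !inE.
have [->|fe] := eqVneq f e; first by rewrite X'e Ye.
have [->|fa] := eqVneq f a; first by rewrite (negbTE X'a0) andbF.
rewrite same //; apply/negP => /andP[Yf /eqP Xf].
by rewrite (Da f) ?eqxx in fa.
Qed.

(** * Improving pivots, and pairs without them *)

(* The elements through which a pivot from [X] in the direction of [Y] can leave
   the support of [X]; leaving through an element outside [agree X Y] brings [X]
   closer to [Y]. *)
Definition exits X Y : {set E} :=
  [set e | [exists a, exists X', [&& pivot X a e X', Y a != None & X' a == Y a]]].

Lemma exitsP X Y e : reflect
  (exists a X', [/\ pivot X a e X', Y a != None & X' a = Y a]) (e \in exits X Y).
Proof.
rewrite inE; apply: (iffP existsP) => [[a /existsP[X' /and3P[pv Ya /eqP X'a]]]|].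
  by exists a, X'.
by move=> [a [X' [pv Ya X'a]]]; exists a; apply/existsP; exists X'; rewrite pv Ya X'a eqxx.
Qed.

(** A second zero of [X] outside Y^0 survives the pivot and keeps the zero sets distinct. *)
Lemma good_step X Y : X \in C -> Y \in C -> 1 < #|svzero X :\: svzero Y| ->
    ~~ (exits X Y \subset agree X Y) ->
  exists X', [/\ X' \in C, coc_adj C r X X', svzero X' != svzero Y &
    #|agree X' Y| = #|agree X Y|.+1].
Proof.
move=> XC YC D2 /subsetPn[e /exitsP[a [X' [pv Ya X'a]]] eXY].
have [X'C [Xa _] [Xe _] same] := pivotP pv.
exists X'; rewrite X'C (pivot_adj XC pv) (agree_pivot pv X'a eXY); split=> //.
have aD : a \in svzero X :\: svzero Y by rewrite !inE Xa Ya.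
have /card_gt0P[f] : 0 < #|(svzero X :\: svzero Y) :\ a|.
  by move: D2; rewrite (cardsD1 a) aD.
rewrite !inE => /and3P[fa Yf /eqP Xf]; apply/eqP => /setP/(_ f).
rewrite !in_svzero (negbTE Yf) same ?Xf //.
by apply: contraNneq Xe => <-; rewrite Xf.
Qed.

Lemma exits_avoid X Y c : X \in C -> Y \in C -> svzero X != svzero Y -> c \in agree X Y ->
  exists a e X', [/\ X a = None, Y a != None, pivot X a e X', X' a = Y a &
    forall X'', pivot X a c X'' -> X'' a != Y a].
Proof.
move=> XC YC XY; rewrite inE => /andP[Xc /eqP Yc].
have /set0Pn[b] : svzero Y :\: svzero X != set0 by rewrite svzeroD_neq0 // eq_sym.
rewrite !inE => /andP[Xb /eqP Yb].
have [a [Xa Ya miss]] := pivot_miss XC YC Xc Yc Xb Yb.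
by have [e [X' [pv X'a]]] := pivot_toward XC Xa Ya; exists a, e, X'.
Qed.

(** Any pivot towards [Y] gives an exit [c]; as [c] lies in [agree X Y], [exits_avoid] gives a pivot
    leaving elsewhere. *)
Lemma card_exits X Y : X \in C -> Y \in C -> svzero X != svzero Y ->
  exits X Y \subset agree X Y -> 1 < #|exits X Y|.
Proof.
move=> XC YC XY /subsetP stuck.
have /set0Pn[a] := svzeroD_neq0 XC YC XY; rewrite !inE => /andP[Ya /eqP Xa].
have [c [X' [pv X'a]]] := pivot_toward XC Xa Ya.
have cK : c \in exits X Y by apply/exitsP; exists a, X'.
have [a2 [e [X2 [Xa2 Ya2 pv2 X2a miss]]]] := exits_avoid XC YC XY (stuck c cK).
apply/card_gt1P; exists c, e; split=> //; first by apply/exitsP; exists a2, X2.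
by apply/eqP => ce; have := miss X2; rewrite X2a eqxx ce => /(_ pv2).
Qed.

(** Both pivots make [c] a zero, so [X1] and [Y1] share a coline. The agreement gains [a] and [b]
    and loses [c], so the path costs 1 + (N - |agree X Y| - 1) + 1. *)
Lemma dist_common_exit X Y c : X \in C -> Y \in C -> #|svzero X :\: svzero Y| = 2 ->
    c \in agree X Y -> c \in exits X Y -> c \in exits Y X ->
  coc_dist_le C r X Y (N.+1 - #|agree X Y|).
Proof.
move=> XC YC D2 cXY /exitsP[a [X1 [pvX Ya X1a]]] /exitsP[b [Y1 [pvY Xb Y1b]]].
have bnd := agree_bound XC YC.
have [X1C [Xa X1a0] [Xc X1c] sameX] := pivotP pvX.
have [Y1C [Yb Y1b0] [Yc Y1c] sameY] := pivotP pvY.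
have ab : a != b by apply: contraNneq Xb => <-; rewrite Xa.
have ac : a != c by apply: contraNneq Xc => <-; rewrite Xa.
have bc : b != c by apply: contraNneq Yc => <-; rewrite Yb.
have X1b : X1 b = X b by rewrite sameX // eq_sym.
have Y1a : Y1 a = Y a by rewrite sameY.
have D1 : svzero X1 :\: svzero Y1 = (svzero X :\: svzero Y) :\ a.
  apply/setP => f; rewrite !inE.
  have [->|fa] := eqVneq f a; first by rewrite (negbTE X1a0) andbF.
  have [->|fc] := eqVneq f c; first by rewrite Y1c eqxx (negbTE Xc) andbF.
  have [->|fb] := eqVneq f b; first by rewrite X1b (negbTE Xb) !andbF.
  by rewrite sameX // sameY.
have agr : #|agree X1 Y1| = #|agree X Y|.+1.
  have -> : agree X1 Y1 = a |: (b |: agree X Y :\ c).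
    apply/setP => f; rewrite !inE.
    have [->|fa] := eqVneq f a; first by rewrite X1a0 X1a Y1a eqxx.
    have [->|fb] := eqVneq f b; first by rewrite X1b Xb Y1b eqxx.
    have [->|fc] := eqVneq f c; first by rewrite X1c.
    by rewrite sameX // sameY.
  rewrite !cardsU1 (cardsD1 c (agree X Y)) cXY !inE Xa Yb (negbTE ab) (negbTE bc) /=.
  by case: (X b) Xb; rewrite ?andbF.
have /eqP/cards1P[a' Da'] : #|svzero X1 :\: svzero Y1| = 1.
  by apply/eqP; rewrite -eqSS -D2 (cardsD1 a (svzero X :\: svzero Y)) D1 !inE Xa Ya.
have Y1Y : coc_adj C r Y1 Y by rewrite coc_adj_sym (pivot_adj YC pvY).
apply: dist_le_leq (dist_le_trans (dist_le_trans (dist_le_adj (pivot_adj XC pvX))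
  (coline_dist X1C Y1C Da')) (dist_le_adj Y1Y)).
by rewrite agr; move: bnd; rewrite D2; clear; lia.
Qed.

(** The path runs through [X], [X1], [X2], [Y2], [Y]. The middle pair shares a coline and agrees at
    [c], [a], [a3] and [b2], hence is at distance at most 5 - 4. *)
Lemma dist_two_exits X Y c d a3 X1 : X \in C -> Y \in C -> N = 5 ->
    #|svzero X :\: svzero Y| = 3 -> agree X Y = [set c; d] -> c != d ->
    exits Y X \subset agree X Y -> pivot X a3 d X1 -> Y a3 != None -> X1 a3 = Y a3 ->
    (forall a, X a = None -> Y a != None -> a != a3 ->
       exists2 X', pivot X a c X' & X' a = Y a) ->
  coc_dist_le C r X Y 4.
Proof.
move=> XC YC N5 D3 agrXY cd /subsetP stuck pv1 Ya3 X1a3 allc.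
have [X1C [Xa3 X1a3n] [Xd X1d] same1] := pivotP pv1.
have [cXY dXY] : c \in agree X Y /\ d \in agree X Y by rewrite agrXY !inE !eqxx orbT.
move: cXY dXY; rewrite !inE Xd /= => /andP[Xc /eqP Yc] /eqP Yd.
have Yc0 : Y c != None by rewrite Yc.
have Yd0 : Y d != None by rewrite Yd.
have neq (Z : svec E) f g : Z f != None -> Z g = None -> f != g.
  by move=> Zf Zg; apply: contraNneq Zf => ->; rewrite Zg.
have B3 := card_svzeroD YC XC; rewrite D3 in B3.
(* The 2 elements of [agree X Y] and the 3 of Y^0 \ X^0 fill the support of [X]. *)
have suppX e : X e != None -> e \notin agree X Y -> Y e = None.
  move=> Xe eXY; have : e \in agree X Y :|: (svzero Y :\: svzero X).
    have/eqP-> : agree X Y :|: (svzero Y :\: svzero X) == ~: svzero X.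
      rewrite eqEcard card_supp // N5; apply/andP; split.
        by apply/subsetP => f; rewrite !inE; case: (X f).
      rewrite cardsU B3 agrXY cards2 cd.
      suff -> : [set c; d] :&: (svzero Y :\: svzero X) = set0 by rewrite cards0.
      apply/setP => f; rewrite -agrXY !inE.
      by case: (X f) => [[]|]; case: (Y f) => [[]|].
    by rewrite !inE.
  by rewrite in_setU (negbTE eXY) !inE Xe => /eqP.
have exitY b e Y' : pivot Y b e Y' -> X b != None -> Y' b = X b -> e != c -> e = d.
  move=> pv Xb Y'b ec; have : e \in agree X Y by apply: stuck; apply/exitsP; exists b, Y'.
  by rewrite agrXY !inE (negbTE ec) => /eqP.
(* [Y1] serves to find [a]. Pivots from [Y] towards [X] leave through [c] or [d], so one that misses
   [c] makes [d] a zero, as in [X1]. *)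
have [b [Yb Xb missb]] := pivot_miss YC XC Yc0 (esym Yc) Ya3 Xa3.
have [e1 [Y1 [pvY1 Y1b]]] := pivot_toward YC Yb Xb.
have e1d : e1 = d.
  by apply: (exitY _ _ _ pvY1) => //; apply: contraTneq (eqxx (Y1 b)) => e1c;
     rewrite {2}Y1b missb // -e1c.
rewrite e1d in pvY1; have [Y1C [_ Y1b0] [_ Y1d] sameY1] := pivotP pvY1.
have X1c : X1 c = X c by apply: same1 => //; apply: (neq X).
have Y1c : Y1 c = X c by rewrite -Yc; apply: sameY1 => //; apply: (neq Y).
have [b' [Yb' Xb' bb']] : exists b', [/\ Y b' = None, X b' != None & b' != b].
  have /card_gt0P[b'] : 0 < #|(svzero Y :\: svzero X) :\ b|.
    by move: B3; rewrite (cardsD1 b) !inE Yb Xb add1n => -[->].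
  by rewrite !inE => /and3P[? ? /eqP]; exists b'.
have X1b' : X1 b' != None by rewrite same1 //; [exact: (neq X)|rewrite eq_sym; exact: (neq Y)].
have Y1b' : Y1 b' = None by rewrite sameY1 //; rewrite eq_sym; apply: (neq Y).
have [||a [X1a Y1a missa]] := pivot_miss X1C Y1C (c := c) _ _ X1b' Y1b'.
- by rewrite X1c.
- by rewrite X1c Y1c.
have [e [X2 [pv2 X2a]]] := pivot_toward X1C X1a Y1a.
have ec : e != c by apply/eqP => ec; have := missa X2; rewrite -ec X2a eqxx => /(_ pv2).
have [X2C [_ X2an] [X1e X2e] same2] := pivotP pv2.
have aa3 : a != a3 by rewrite eq_sym; apply: (neq X1).
have ad : a != d by apply: (neq Y1).
have Xa : X a = None by rewrite -same1.
have ab : a != b by rewrite eq_sym; apply: (neq X).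
have Ya : Y a != None by rewrite -sameY1.
have X2aY : X2 a = Y a by rewrite X2a sameY1.
have ac : a != c by rewrite eq_sym; apply: (neq X).
have X2c : X2 c = X c by rewrite same2 // eq_sym.
have ed : e != d by apply: (neq X1).
have X2d : X2 d = None by rewrite same2 // eq_sym.
have a_only f : X2 f != None -> X1 f = None -> f = a.
  move=> X2f X1f; apply: contraNeq X2f => fa; rewrite same2 ?X1f //.
  by rewrite eq_sym; apply: (neq X1).
(* Otherwise X2^0 is X^0 with [a] replaced by [d], and [pivot_miss] towards [X2] forbids the pivot
   of [a] through [c] that [allc] grants. *)
have ea3 : e != a3.
  apply/eqP => eqe; have [a' [Xa' X2a' missa']] := pivot_miss XC X2C Xc X2c Xd X2d.
  have a'a : a' = a.
    apply: a_only => //; rewrite same1 //; last by rewrite eq_sym; apply: (neq X).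
    by rewrite -eqe; apply: (neq X2).
  have [X' pvX' X'a] := allc a Xa Ya aa3.
  by have := missa' X'; rewrite a'a X'a X2aY eqxx => /(_ pvX').
have Xe : X e != None by rewrite -same1.
have Ye : Y e = None by apply: suppX; rewrite // agrXY !inE negb_or ec ed.
(* [X2] and [X] have the same sign at [b2], so this pivot also heads towards [X]; missing [c], it
   leaves through [d]. *)
have [b2 [Yb2 X2b2 missb2]] := pivot_miss YC X2C Yc0 (etrans X2c (esym Yc)) Yd0 X2d.
have b2a : b2 != a by rewrite eq_sym; apply: (neq Y).
have b2a3 : b2 != a3 by rewrite eq_sym; apply: (neq Y).
have b2d : b2 != d by rewrite eq_sym; apply: (neq Y).
have b2c : b2 != c by rewrite eq_sym; apply: (neq Y).
have b2e : b2 != e by apply: (neq X2).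
have X2b2E : X2 b2 = X b2 by rewrite same2 // same1.
have Xb2 : X b2 != None by rewrite -X2b2E.
have [e2 [Y2 [pvY2 Y2b2]]] := pivot_toward YC Yb2 X2b2.
have e2d : e2 = d.
  apply: (exitY _ _ _ pvY2) => //; first by rewrite Y2b2.
  by apply/eqP => e2c; have := missb2 Y2; rewrite Y2b2 eqxx -e2c => /(_ pvY2).
rewrite e2d in pvY2; have [Y2C [_ Y2b20] [_ Y2d] sameY2] := pivotP pvY2.
have Y2e : Y2 e = None by rewrite sameY2 // eq_sym.
have D2 : svzero X2 :\: svzero Y2 = (svzero X :\: svzero Y) :\ a :\ a3.
  apply/setP => f; rewrite !inE.
  have [->|fa] := eqVneq f a; first by rewrite (negbTE X2an) !andbF.
  have [->|fe] := eqVneq f e; first by rewrite Y2e (negbTE Xe) !andbF.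
  have [->|fa3] := eqVneq f a3; first by rewrite same2 1?eq_sym // (negbTE X1a3n) !andbF.
  have [->|fd] := eqVneq f d; first by rewrite Y2d (negbTE Xd) !andbF.
  have [->|fb2] := eqVneq f b2; first by rewrite (negbTE X2b2) (negbTE Xb2) !andbF.
  by rewrite same2 // same1 // sameY2.
have /eqP/cards1P[o Do] : #|svzero X2 :\: svzero Y2| = 1.
  move: D3; rewrite D2 (cardsD1 a) (cardsD1 a3) !inE Xa Xa3 Ya Ya3 /= eq_sym aa3.
  by rewrite !add1n => -[].
have agr2 : 4 <= #|agree X2 Y2|.
  have <- : #|c |: (a |: (a3 |: [set b2]))| = 4.
    by rewrite !cardsU1 cards1 !inE !negb_or aa3 ![_ == b2]eq_sym b2a b2a3 b2c
      [c == _]eq_sym ac (neq X c a3).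
  apply/subset_leq_card/subsetP => f; rewrite !inE.
  case/or4P=> /eqP->.
  - by rewrite X2c Xc sameY2 ?Yc ?eqxx // eq_sym.
  - by rewrite X2aY Ya sameY2 ?eqxx // eq_sym.
  - have a3d : a3 != d by rewrite eq_sym; apply: (neq X).
    have X2a3 : X2 a3 = Y a3 by rewrite same2 // eq_sym.
    by rewrite X2a3 Ya3 sameY2 ?eqxx // eq_sym.
  by rewrite X2b2 Y2b2 eqxx.
have Y2Y : coc_adj C r Y2 Y by rewrite coc_adj_sym (pivot_adj YC pvY2).
apply: dist_le_leq (dist_le_trans (dist_le_trans (dist_le_trans
  (dist_le_adj (pivot_adj XC pv1)) (dist_le_adj (pivot_adj X1C pv2)))
  (coline_dist X2C Y2C Do)) (dist_le_adj Y2Y)).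
by rewrite N5; move: agr2; clear; lia.
Qed.

(** * Upper bound on the diameter *)

(** Induction on the bound: an improving pivot on either side lowers it by one. Otherwise each side
    has at least two exits, all in [agree X Y]. *)
Lemma dist_le_agree X Y : X \in C -> Y \in C -> N <= 5 -> svzero X != svzero Y ->
  coc_dist_le C r X Y (N.+1 - #|agree X Y|).
Proof.
move=> XC YC N5 XY; move: {2}(_ - #|_|) (leqnn (N.+1 - #|agree X Y|)) => m.
elim: m X Y XC YC XY => [|m IH] X Y XC YC XY le.
  by move: (agree_bound XC YC) le; clear; lia.
have bnd := agree_bound XC YC; have D0 := svzeroD_neq0 XC YC XY.
have [D1|D2] := leqP #|svzero X :\: svzero Y| 1.
  have /cards1P[a Da] : #|svzero X :\: svzero Y| == 1 by rewrite eqn_leq D1 card_gt0.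
  by apply: dist_le_leq (coline_dist XC YC Da); apply: leq_sub2r.
have D2' : 1 < #|svzero Y :\: svzero X| by rewrite card_svzeroD.
have [stuckX|good] := boolP (exits X Y \subset agree X Y); last first.
  have [X' [X'C adj X'Y agr]] := good_step XC YC D2 good.
  apply: dist_le_leq (dist_le_trans (dist_le_adj adj) (IH _ _ X'C YC X'Y _)).
    by rewrite agr; move: bnd; clear; lia.
  by rewrite agr; move: le; clear; lia.
have [stuckY|good] := boolP (exits Y X \subset agree Y X); last first.
  have [Y' [Y'C adj Y'X agr]] := good_step YC XC D2' good.
  rewrite !(agreeC _ X) in agr.
  rewrite coc_adj_sym in adj; rewrite eq_sym in Y'X.
  apply: dist_le_leq (dist_le_trans (IH _ _ XC Y'C Y'X _) (dist_le_adj adj)).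
    by rewrite agr; move: bnd; clear; lia.
  by rewrite agr; move: le; clear; lia.
have YX : svzero Y != svzero X by rewrite eq_sym.
have eX := card_exits XC YC XY stuckX; have eY := card_exits YC XC YX stuckY.
rewrite agreeC in stuckY; have leX := subset_leq_card stuckX.
have [D3|D3] := leqP #|svzero X :\: svzero Y| 2.
  have D2E : #|svzero X :\: svzero Y| = 2 by apply/eqP; rewrite eqn_leq D3.
  (* The agreement has at most 5 - 2 elements, so two subsets with at least two elements each must
     meet. *)
  have /set0Pn[c] : exits X Y :&: exits Y X != set0.
    apply: contraTneq N5 => I0; have := cardsUI (exits X Y) (exits Y X).
    have := subset_leq_card (_ : exits X Y :|: exits Y X \subset agree X Y).
    rewrite subUset stuckX stuckY I0 cards0 => /(_ isT).
    by move: bnd eX eY; rewrite D2E; clear; lia.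
  case/setIP=> cX cY; apply: (dist_common_exit XC YC D2E _ cX cY).
  exact: (subsetP stuckX).
(* The summands are at least 2 and 3, with sum at most [N <= 5]. *)
have [N5E D3E agr2] : [/\ N = 5, #|svzero X :\: svzero Y| = 3 & #|agree X Y| = 2].
  by split; move: bnd N5 D3 eX leX; clear; lia.
have [c1 c1X] : exists c, c \in exits X Y.
  by apply/set0Pn; rewrite -card_gt0; apply: ltnW.
have /exitsP[a1 [Z1 [pv1 Ya1 Z1a]]] := c1X.
have c1agr := subsetP stuckX _ c1X.
have [a2 [c2 [Z2 [Xa2 Ya2 pv2 Z2a miss]]]] := exits_avoid XC YC XY c1agr.
have c12 : c1 != c2 by apply/eqP => c12; have := miss Z2; rewrite Z2a eqxx c12 => /(_ pv2).
have Xa1 : X a1 = None by have [_ []] := pivotP pv1.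
have a12 : a1 != a2 by apply/eqP => a12; have := miss Z1; rewrite -a12 Z1a eqxx => /(_ pv1).
have exitX e a Z : pivot X a e Z -> Y a != None -> Z a = Y a -> e \in agree X Y.
  by move=> *; apply: (subsetP stuckX); apply/exitsP; exists a, Z.
have agrE : agree X Y = [set c1; c2].
  apply/esym/eqP; rewrite eqEcard subUset !sub1set c1agr (exitX _ _ _ pv2) //.
  by rewrite cards2 c12 agr2.
have /card_gt0P[a3] : 0 < #|(svzero X :\: svzero Y) :\ a1 :\ a2|.
  move: D3E; rewrite (cardsD1 a1) (cardsD1 a2) !inE Xa1 Xa2 Ya1 Ya2 [a2 == a1]eq_sym a12.
  by rewrite !add1n => -[->].
rewrite !inE => /and4P[a32 a31 Ya3 /eqP Xa3].
have DE a : X a = None -> Y a != None -> [\/ a = a1, a = a2 | a = a3].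
  move=> Xa Ya; have : a \in svzero X :\: svzero Y by rewrite !inE Xa Ya.
  have/eqP<- : a1 |: (a2 |: [set a3]) == svzero X :\: svzero Y.
    rewrite eqEcard !subUset !sub1set !inE Xa1 Ya1 Xa2 Ya2 Xa3 Ya3 !eqxx D3E.
    by rewrite !cardsU1 cards1 !inE !negb_or a12 ![_ == a3]eq_sym a31 a32.
  by rewrite !inE => /or3P[]/eqP->; constructor.
(* Two of the three chosen pivots share an exit; the zero of the remaining one plays [a3] in
   [dist_two_exits]. *)
have [c3 [Z3 [pv3 Z3a]]] := pivot_toward XC Xa3 Ya3.
rewrite N5E agr2; have := exitX _ _ _ pv3 Ya3 Z3a; rewrite agrE => /set2P[] c3E.
  rewrite c3E in pv3; apply: (dist_two_exits XC YC N5E D3E agrE c12 stuckY pv2 Ya2 Z2a).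
  by move=> a Xa Ya; case: (DE a Xa Ya) => ->; rewrite ?eqxx // => _; [exists Z1|exists Z3].
rewrite setUC in agrE; rewrite eq_sym in c12; rewrite c3E in pv3.
apply: (dist_two_exits XC YC N5E D3E agrE c12 stuckY pv1 Ya1 Z1a).
by move=> a Xa Ya; case: (DE a Xa Ya) => ->; rewrite ?eqxx // => _; [exists Z2|exists Z3].
Qed.

(** For antipodes, any pivot from [X] leaves [e] as the only zero of [X'] outside Y^0, so
    [coline_dist] applies. *)
Lemma dist_le_diam X Y : X \in C -> Y \in C -> N <= 5 -> coc_dist_le C r X Y N.+1.
Proof.
move=> XC YC N5; have [XY|XY] := eqVneq (svzero X) (svzero Y); last first.
  by apply: dist_le_leq (dist_le_agree XC YC N5 XY); apply: leq_subr.
have [|->|XNY] := @svzero_sub_eq X Y XC YC; first by rewrite XY.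
  exact: dist_le_leq (dist_le0 Y).
have /set0Pn[a] : svzero X != set0 by rewrite -card_gt0 unif // rB1.
rewrite in_svzero => /eqP Xa; have [e [X' [pv _]]] := pivot_exists true XC Xa.
have [X'C [_ X'a] [Xe X'e] same] := pivotP pv.
have D : svzero X' :\: svzero Y = [set e].
  apply/setP => f; rewrite -XY !inE.
  have [->|fa] := eqVneq f a; first by rewrite Xa; apply/esym/eqP => ae; rewrite -ae Xa in Xe.
  have [->|fe] := eqVneq f e; first by rewrite X'e Xe.
  by rewrite same // andNb.
apply: dist_le_leq (dist_le_trans (dist_le_adj (pivot_adj XC pv)) (coline_dist X'C YC D)).
by rewrite add1n ltnS leq_subr.
Qed.

(** * Lower bound from antipodes *)

(** As no sign is reversed, new agreement arises only at zeros of [X] that [X'] loses, and adjacency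
    permits at most one. *)
Lemma agree_adj X X' Y : coc_adj C r X X' -> #|agree X' Y| <= #|agree X Y|.+1.
Proof.
case/and5P=> XC X'C _ cXX' /eqP sep.
apply: leq_trans (_ : #|agree X Y :|: (svzero X :\: svzero X')| <= _).
  apply/subset_leq_card/subsetP => f; rewrite !inE => /andP[X'f Yf]; rewrite X'f.
  have /setP/(_ f) := sep; rewrite in_svsep inE.
  by case: (X f) (X' f) (Y f) X'f Yf => [[]|] [[]|] [[]|].
rewrite -addn1; apply: leq_trans (leq_card_setU _ _) _; rewrite leq_add2l.
by rewrite cardsD unif // leq_subLR addn1 rB1 ltnS.
Qed.

Lemma agree_path X p Y : path (coc_adj C r) X p ->
  #|agree (last X p) Y| <= #|agree X Y| + size p.
Proof.
elim: p X => [|X' p IH] X /=; first by rewrite addn0.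
case/andP=> XX' /IH le; apply: leq_trans le _.
by rewrite addnS -addSn leq_add2r agree_adj.
Qed.

(* The first step towards [svneg X] creates no agreement, and each later step
   creates at most one. *)
Lemma antipodal_dist X k : X \in C -> coc_dist_le C r X (svneg X) k -> N < k.
Proof.
move=> XC [[|X' p] [XX' lastX szp]].
  have [e Xe] := cocircuit_neq0 XC.
  by move: lastX => /= /(congr1 (fun Z : svec E => Z e)); rewrite ffunE; case: (X e) Xe => [[]|].
move: XX' lastX szp => /= /andP[XX' X'p] lastX; apply: leq_trans; rewrite ltnS.
have := agree_path (svneg X) X'p; rewrite lastX.
have -> : agree X' (svneg X) = set0.
  have /and5P[_ _ _ _ /eqP sep] := XX'.
  apply/setP => f; have /setP/(_ f) := sep; rewrite in_svsep !inE ffunE.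
  by case: (X f) (X' f) => [[]|] [[]|].
rewrite cards0; apply: leq_trans; rewrite -(card_supp (svneg_mem XC)).
by apply/subset_leq_card/subsetP => f; rewrite !inE eqxx andbT.
Qed.

Lemma rank_le_card : r <= #|E|.
Proof.
case: rank => [[s [<- _ chain]] _].
exact: leq_trans (path_svlt_size chain) (max_card _).
Qed.

Lemma cocircuit_exists : exists X, X \in C.
Proof.
have [|X XC _] := @zero_set_exists [set x in take (r - 1) (enum E)]; last by exists X.
rewrite cardsE (card_uniqP (take_uniq _ (enum_uniq _))) size_takel // -cardE.
exact: leq_trans (leq_subr _ _) rank_le_card.
Qed.

End OrientedMatroid.

Theorem theorem4p5 (E : finType) (C : {set svec E}) (n r : nat) :
  #|E| = n -> is_OM C -> OM_rank C r -> uniform C r ->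
  2 <= r -> n - r <= 4 ->
  coc_diam_eq C r (n - r + 2).
Proof.
move=> cE OM rank unif r_ge2 nr4.
(* Subtraction truncates, so this needs [r <= n], which a chain of length [r] provides. *)
have NE : n - r + 2 = (#|E| - (r - 1)).+1.
  by have := rank_le_card rank; rewrite cE; move: r_ge2; clear; lia.
rewrite NE; split=> [X Y XC YC|].
  by apply: dist_le_diam; rewrite // -ltnS -NE addn2 !ltnS.
have [X XC] := cocircuit_exists OM rank unif r_ge2.
exists X, (svneg X); split=> //; first exact: svneg_mem.
by move=> k; apply: antipodal_dist.
Qed.
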